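(* For any centrally L-bounded poset $P$, both $\mathbf 1\oplus P$ and $P\oplus\mathbf 1$ are centrally L-bounded. Furthermore, $\mathbf 1\oplus P\oplus\mathbf 1$ is uniformly L-bounded.
   Context: All posets are finite and nonempty. Let $[n]=\{1,\dots,n\}$; families of subsets of $[n]$ are ordered by inclusion. A poset $(P,\le)$ contains a poset $(P',\le')$ as a (weak) subposet if there is an injection $f:P'\to P$ such that $u\le' v$ implies $f(u)\le f(v)$. A family $\mathcal F\subseteq 2^{[n]}$ is $P$-free if it does not contain $P$ in this sense. $e(P)$ is the maximum integer $k\ge 0$ such that for all integers $n$ and $s$ the family $\binom{[n]}{s}\cup\binom{[n]}{s+1}\cup\cdots\cup\binom{[n]}{s+k-1}$ is $P$-free, where $\binom{[n]}{j}$ is the collection of $j$-element subsets of $[n]$ (empty if $j<0$ or $j>n$). The Lubell function of $\mathcal F\subseteq 2^{[n]}$ is the average over all $n!$ full (maximal) chains $\mathcal C$ of $2^{[n]}$ of $|\mathcal F\cap\mathcal C|$; equivalently $\bar h_n(\mathcal F)=\sum_{F\in\mathcal F}1/\binom{n}{|F|}$. $P$ is uniformly L-bounded if for all $n$, $\bar h_n(\mathcal F)\le e(P)$ for every $P$-free family $\mathcal F\subseteq 2^{[n]}$. $P$ is centrally L-bounded if for all $n$, $\bar h_n(\mathcal F)\le e(P)$ for every $P$-free family $\mathcal F\subseteq 2^{[n]}$ with $\emptyset,[n]\notin\mathcal F$. The ordinal sum $P_1\oplus P_2$ of disjoint posets is the set $P_1\cup P_2$ ordered by $x\le y$ if $x\in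 P_1$ and $y\in P_2$, or if $x,y$ lie in the same $P_i$ with $x\le y$ there. $\mathbf 1$ denotes the one-element poset. *)

(* Defs.v *)
From HB Require Import structures.
From mathcomp Require Import all_boot all_order all_algebra all_fingroup.
From mathcomp Require Import boolp.
From mathcomp Require classical_sets.

Set Implicit Arguments.
Unset Strict Implicit.
Unset Printing Implicit Defensive.

Import Order.TTheory GRing.Theory Num.Theory.

Fact osum_display (d1 d2 : Order.disp_t) : Order.disp_t.
Proof. exact: d1. Qed.

Definition osum (T1 T2 : Type) : Type := (T1 + T2)%type.

Section OrdinalSum.
Context (d1 d2 : Order.disp_t).

HB.instance Definition _ (T1 T2 : finType) := Finite.on (osum T1 T2).

Context (P1 : finPOrderType d1) (P2 : finPOrderType d2).

Definition osum_le (x y : osum P1 P2) : bool :=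
  match x, y with
  | inl a, inl b => (a <= b)%O
  | inr a, inr b => (a <= b)%O
  | inl _, inr _ => true
  | inr _, inl _ => false
  end.

Fact osum_le_refl : reflexive osum_le.
Proof. by case=> a /=. Qed.

Fact osum_le_anti : antisymmetric osum_le.
Proof. by case=> [a|a] [b|b] //= /le_anti ->. Qed.

Fact osum_le_trans : transitive osum_le.
Proof. by case=> [b|b] [a|a] [c|c] //=; apply: le_trans. Qed.

HB.instance Definition _ :=
  Order.Le_isPOrder.Build (osum_display d1 d2) (osum P1 P2)
    osum_le_refl osum_le_anti osum_le_trans.

End OrdinalSum.

Notation "P1 ⊕ P2" := (osum P1 P2) (at level 50, left associativity).

Definition contains_poset (d : Order.disp_t) (P : finPOrderType d) (n : nat)
    (F : {set {set 'I_n}}) : Prop :=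
  exists f : P -> {set 'I_n},
    [/\ injective f, forall u, f u \in F &
        forall u v, (u <= v)%O -> f u \subset f v].

Definition poset_free (d : Order.disp_t) (P : finPOrderType d) (n : nat)
    (F : {set {set 'I_n}}) : Prop := ~ contains_poset P F.

(* The starting level [s] ranges over all integers; levels outside [0, n] are
   empty. *)
Definition level (n : nat) (j : int) : {set {set 'I_n}} :=
  [set A : {set 'I_n} | #|A|%:Z%R == j].

Definition levels (n : nat) (s : int) (k : nat) : {set {set 'I_n}} :=
  \bigcup_(i < k) level n (s + (i : nat)%:Z)%R.

Definition levels_free (d : Order.disp_t) (P : finPOrderType d) (k : nat) :
  Prop := forall (n : nat) (s : int), poset_free P (levels n s k).

(* The maximum exists when [P] is nonempty, see [e_numP]; the default value 0
   is only used for the empty poset. *)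
Definition e_num (d : Order.disp_t) (P : finPOrderType d) : nat :=
  classical_sets.xget 0
    (fun k => levels_free P k /\ forall m, levels_free P m -> m <= k).

Definition full_chains (n : nat) : {set {set {set 'I_n}}} :=
  [set C : {set {set 'I_n}} |
    maxset (fun D : {set {set 'I_n}} =>
      [forall A in D, forall B in D, (A \subset B) || (B \subset A)]) C].

Definition lubell (n : nat) (F : {set {set 'I_n}}) : rat :=
  ((\sum_(C in full_chains n) #|F :&: C|)%:R / #|full_chains n|%:R)%R.

Definition uniformly_L_bounded (d : Order.disp_t) (P : finPOrderType d) :
  Prop :=
  forall (n : nat) (F : {set {set 'I_n}}),
    poset_free P F -> (lubell F <= (e_num P)%:R)%R.

Definition centrally_L_bounded (d : Order.disp_t) (P : finPOrderType d) :
  Prop :=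
  forall (n : nat) (F : {set {set 'I_n}}),
    poset_free P F -> set0 \notin F -> [set: 'I_n] \notin F ->
    (lubell F <= (e_num P)%:R)%R.

Lemma e_numP (d : Order.disp_t) (P : finPOrderType d) : 0 < #|P| ->
  levels_free P (e_num P) /\ forall m, levels_free P m -> m <= e_num P.
Proof.
move=> /card_gt0P[p0 _]; rewrite /e_num.
pose Q k := levels_free P k /\ forall m, levels_free P m -> m <= k.
suff: exists k, Q k by move/(classical_sets.xgetPex 0).
have free0 : levels_free P 0.
  by move=> n s [f [_ fF _]]; have := fF p0; rewrite /levels big_ord0 inE.
have bnd k : levels_free P k -> k <= #|P|.
  move=> freek; rewrite leqNgt; apply/negP => ltPk.
  apply: (freek #|P| 0%R).
  exists (fun u => [set enum_rank v | v : P & (v <= u)%O]); split.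
  - move=> u v /imset_inj E; apply: le_anti.
    have {}E := E (@enum_rank_inj _); move/setP: E => E.
    by have := E u; have := E v; rewrite !inE !lexx => -> <-.
  - move=> u; set A := [set _ | _ in _].
    have ltAk : #|A| < k by apply: leq_ltn_trans ltPk; rewrite -[X in _ <= X]card_ord max_card.
    apply/bigcupP; exists (Ordinal ltAk) => //.
    by rewrite inE add0r.
  - move=> u v le_uv; apply: imsetS; apply/subsetP => w; rewrite !inE => le_wu.
    exact: le_trans le_uv.
have exb : exists k, `[< levels_free P k >] by exists 0; apply/asboolP.
have bndb k : `[< levels_free P k >] -> k <= #|P| by move/asboolP/bnd.
case: (ex_maxnP exb bndb) => k /asboolP freek maxk.
by exists k; split=> // m /asboolP/maxk.
Qed.

Section Lubell.
Variable n : nat.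
Implicit Types (A B : {set 'I_n}) (C D F : {set {set 'I_n}}).

Let is_chain D :=
  [forall A in D, forall B in D, (A \subset B) || (B \subset A)].

Let is_chainP D :
  reflect {in D &, forall A B, (A \subset B) || (B \subset A)} (is_chain D).
Proof.
apply: (iffP forall_inP) => [H A B AD BD|H A AD].
  exact: (forall_inP (H A AD)).
by apply/forall_inP => B; apply: H.
Qed.

Lemma full_chains_gt0 : 0 < #|full_chains n|.
Proof.
have chain0 : is_chain set0 by apply/is_chainP => A B; rewrite inE.
have [C maxC _] := maxset_exists chain0.
by apply/card_gt0P; exists C; rewrite inE.
Qed.

Lemma full_chain_level C (k : nat) : C \in full_chains n -> k <= n ->
  #|[set A in C | #|A| == k]| = 1.
Proof.
rewrite inE => maxC le_kn.
have /is_chainP chC := maxsetp maxC.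
have addC (D : {set 'I_n}) : {in C, forall A, (A \subset D) || (D \subset A)} -> D \in C.
  move=> cmpD; rewrite -(maxsetsup maxC _ (subsetUr [set D] C)); last first.
    apply/is_chainP => A B; rewrite !inE => /orP[/eqP->|AC] /orP[/eqP->|BC].
    - by rewrite subxx.
    - by rewrite orbC cmpD.
    - by rewrite cmpD.
    - exact: chC.
  by rewrite !inE eqxx.
suff [D DC cardD] : exists2 D : {set 'I_n}, D \in C & #|D| = k.
  apply/eqP/cards1P; exists D; apply/setP => A; rewrite !inE.
  apply/andP/eqP => [[AC /eqP cardA]|->]; last by rewrite DC cardD.
  case/orP: (chC _ _ AC DC) => sub; last apply/esym; apply/eqP;
  by rewrite eqEcard sub cardA cardD leqnn.
have C0 : set0 \in C by apply: addC => A _; rewrite sub0set orbT.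
have CT : setT \in C by apply: addC => A _; rewrite subsetT.
pose lo A := (A \in C) && (#|A| <= k).
pose hi A := (A \in C) && (k <= #|A|).
have lo0 : lo set0 by rewrite /lo C0 cards0.
have hiT : hi setT by rewrite /hi CT cardsT card_ord.
case: (arg_maxnP (fun A => #|A|) lo0) => A /andP[AC leAk] maxA.
case: (arg_minnP (fun A => #|A|) hiT) => B /andP[BC lekB] minB.
have sAB : A \subset B.
  case/orP: (chC _ _ AC BC) => // sBA.
  suff /eqP-> : B == A by [].
  by rewrite eqEcard sBA (leq_trans leAk).
have [D [sAD sDB cardD]] : exists D : {set 'I_n}, [/\ A \subset D, D \subset B & #|D| = k].
  have le_kd : k - #|A| <= #|B :\: A|.
    by rewrite cardsD (setIidPr sAB) leq_sub2r.
  have : [exists E : {set 'I_n}, (E \subset B :\: A) && (#|E| == k - #|A|)].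
    have : 0 < #|[set E : {set 'I_n} | E \subset B :\: A & #|E| == k - #|A|]|.
      by rewrite cards_draws bin_gt0.
    by case/card_gt0P => E; rewrite inE => EP; apply/existsP; exists E.
  case/existsP => E /andP[/subsetDP[sEB dEA] /eqP cardE].
  exists (A :|: E); split; first exact: subsetUl.
    by rewrite subUset sAB.
  rewrite cardsU disjoint_setI0 1?disjoint_sym // cards0 subn0 cardE.
  by rewrite subnKC.
exists D => //; apply: addC => X XC.
have [leXk|ltkX] := leqP #|X| k.
  have := maxA X; rewrite /lo XC leXk => /(_ isT) leXA.
  suff sXA : X \subset A by rewrite (subset_trans sXA).
  case/orP: (chC _ _ XC AC) => // sAX.
  by suff /eqP-> : A == X by []; rewrite eqEcard sAX.
have := minB X; rewrite /hi XC (ltnW ltkX) => /(_ isT) leBX.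
suff sBX : B \subset X by rewrite (subset_trans sDB) ?orbT.
case/orP: (chC _ _ XC BC) => // sXB.
by suff /eqP-> : X == B by []; rewrite eqEcard sXB.
Qed.

Let perm_card A B : #|A| = #|B| -> exists s : {perm 'I_n}, [set s x | x in A] = B.
Proof.
move=> eqAB; pose l (X : {set 'I_n}) := enum X ++ enum (~: X).
have uniql X : uniq (l X).
  rewrite cat_uniq !enum_uniq andbT /=; apply/hasPn => x.
  by rewrite !mem_enum !inE.
have lT X x : x \in l X by rewrite mem_cat !mem_enum !inE orbN.
have sizel X : size (l X) = n.
  by rewrite size_cat -!cardE cardsC card_ord.
pose f x := nth x (l B) (index x (l A)).
have ltf x : index x (l A) < size (l B).
  by rewrite (sizel B) -[X in _ < X](sizel A) index_mem.
have injf : injective f.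
  move=> x y; rewrite /f (set_nth_default y) // => /eqP.
  rewrite nth_uniq // => /eqP eqi.
  by rewrite -(nth_index x (lT A x)) eqi nth_index.
exists (perm injf); apply/eqP; rewrite eqEcard card_imset ?eqAB ?leqnn ?andbT;
  last exact: perm_inj.
apply/subsetP => _ /imsetP[x Ax ->]; rewrite permE /f.
have ltx : index x (l A) < size (enum B).
  by rewrite index_cat mem_enum Ax -cardE -eqAB cardE index_mem mem_enum.
by rewrite nth_cat ltx -mem_enum mem_nth.
Qed.

Let cnt A := #|[set C in full_chains n | A \in C]|.

Let le_cnt A B : #|A| = #|B| -> cnt A <= cnt B.
Proof.
move=> /perm_card[s sAB].
pose g A' : {set 'I_n} := [set s x | x in A'].
have injg : injective g by apply: imset_inj; apply: perm_inj.
have gS X Y : (g X \subset g Y) = (X \subset Y).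
  apply/idP/idP => [H|]; last exact: imsetS.
  apply/subsetP => x xX; have := subsetP H (s x).
  rewrite /g !mem_imset; [|exact: perm_inj..].
  exact.
have gonto X : exists Y, X = g Y.
  have [h hK gK] := injF_bij injg; by exists (h X).
have chainG D : is_chain [set g X | X in D] = is_chain D.
  apply/is_chainP/is_chainP => H X Y.
    by move=> XD YD; have := H _ _ (imset_f g XD) (imset_f g YD); rewrite !gS.
  by case/imsetP => X' XD -> /imsetP[Y' YD ->]; rewrite !gS; apply: H.
have injG : injective (fun C => [set g X | X in C]) by apply: imset_inj.
rewrite /cnt -(card_imset _ injG); apply: subset_leq_card.
apply/subsetP => _ /imsetP[C + ->]; rewrite !inE => /andP[maxC AC].
apply/andP; split; last by rewrite -sAB; apply: imset_f.
have chC : is_chain C := maxsetp maxC.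
apply/maxsetP; split; first by rewrite -/(is_chain _) chainG.
move=> D; rewrite -/(is_chain _) => chD sCD.
have [h hG Gh] := injF_bij injG.
have chhD : is_chain (h D) by rewrite -chainG Gh.
rewrite -[LHS]Gh (maxsetsup maxC chhD) //.
apply/subsetP => X XC; have := subsetP sCD (g X).
by rewrite imset_f // -{1}[D]Gh mem_imset //; apply.
Qed.

Lemma lubellE F :
  lubell F = (\sum_(A in F) ('C(n, #|A|)%:R)^-1)%R.
Proof.
have numE : \sum_(C in full_chains n) #|F :&: C| = \sum_(A in F) cnt A.
  transitivity (\sum_(C in full_chains n) \sum_(A | (A \in F) && (A \in C)) 1).
    apply: eq_bigr => C _; rewrite -sum1_card.
    by apply: eq_bigl => A; rewrite inE.
  rewrite (exchange_big_dep (mem F)) //=; last by move=> C A _ /andP[].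
  apply: eq_bigr => A AF; rewrite /cnt -sum1_card.
  by apply: eq_bigl => C; rewrite inE AF.
have cntE A : cnt A * 'C(n, #|A|) = #|full_chains n|.
  have leA : #|A| <= n by rewrite -[X in _ <= X]card_ord max_card.
  transitivity (\sum_(B : {set 'I_n} | #|B| == #|A|) cnt B).
    rewrite (eq_bigr (fun=> cnt A)); last first.
      by move=> B /eqP eqBA; apply/eqP; rewrite eqn_leq !le_cnt.
    by rewrite sum_nat_cond_const mulnC -{1}[n]card_ord -card_draws cardsE.
  rewrite -[RHS]sum1_card.
  rewrite (eq_bigr (fun B : {set 'I_n} =>
    \sum_(C in [set C in full_chains n | B \in C]) 1)); last first.
    by move=> B _; rewrite sum1_card.
  rewrite (exchange_big_dep (mem (full_chains n))) /=; last first.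
    by move=> B C _; rewrite inE => /andP[].
  apply: eq_bigr => C fC; rewrite sum1_card -(full_chain_level fC leA).
  apply: eq_card => B; rewrite unfold_in /= [B \in [set _ in _ | _]]inE.
  by rewrite [C \in [set _ in _ | _]]inE fC andbC.
rewrite /lubell numE natr_sum mulr_suml; apply: eq_bigr => A _.
have := full_chains_gt0; rewrite -(cntE A) muln_gt0 => /andP[cA0 bA0].
by rewrite natrM invfM mulrA divff ?mul1r // pnatr_eq0 -lt0n.
Qed.

End Lubell.

(* Main.v *)
(* Group the full chains by the least element A and the greatest element B of G
   on them. Within a group, the part of the chain between A and B is a uniformly
   random full chain of the interval [A, B], so the chains of the group meet G on
   average in 2 plus the Lubell value of the part of G strictly inside [A, B],
   which is at most 2 + e(P) when that part is P-free. For 1 ⊕ P ⊕ 1 take G = F;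
   for 1 ⊕ P add the full set to F, and for P ⊕ 1 the empty set, which raises the
   Lubell value by exactly 1. Each added point raises e(P) by at least 1, since a
   new bottom or top uses up a level. *)
Require Import Defs.
From mathcomp Require Import all_boot all_order.
From mathcomp Require Import all_algebra all_fingroup.
From mathcomp Require Import zify.

Set Implicit Arguments.
Unset Strict Implicit.
Unset Printing Implicit Defensive.

Import Order.TTheory GRing.Theory Num.Theory.

(** * Growth of [e_num] under a new bottom or top *)

Lemma mem_levels (n : nat) (s : int) (k : nat) (A : {set 'I_n}) :
  (A \in levels n s k) = (s <= #|A|%:Z)%R && (#|A|%:Z < s + k%:Z)%R.
Proof.
apply/bigcupP/andP => [[i _]|[le_sA lt_Ak]].
  by rewrite inE => /eqP ->; have := ltn_ord i; lia.
have lti : absz (#|A|%:Z - s)%R < k by lia.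
by exists (Ordinal lti) => //; rewrite inE /= gez0_abs ?subr_ge0 // addrC subrK.
Qed.

(** The image of the new bottom lies properly inside all other images, so the copy of [P] avoids
    level [s] and fits in the [k] levels from [s + 1] on. *)
Lemma levels_free_osum1l (d : Order.disp_t) (P : finPOrderType d) (k : nat) :
  levels_free P k -> levels_free ('I_1 ⊕ P) k.+1.
Proof.
move=> freeP n s [f [injf fF mono]]; apply: (freeP n (s + 1)%R).
exists (fun u => f (inr u)); split=> [u v /injf [] //|u|u v le_uv].
  have := fF (inr u); have := fF (inl ord0); rewrite !mem_levels.
  have : f (inl ord0) \proper f (inr u).
    by rewrite properEneq mono // andbT; apply/negP => /eqP /injf.
  by move=> /proper_card; lia.
exact: mono.
Qed.

(** Here the copy of [P] avoids the highest level, so the start [s] is kept. *)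
Lemma levels_free_osum1r (d : Order.disp_t) (P : finPOrderType d) (k : nat) :
  levels_free P k -> levels_free (P ⊕ 'I_1) k.+1.
Proof.
move=> freeP n s [f [injf fF mono]]; apply: (freeP n s).
exists (fun u => f (inl u)); split=> [u v /injf [] //|u|u v le_uv].
  have := fF (inl u); have := fF (inr ord0); rewrite !mem_levels.
  have : f (inl u) \proper f (inr ord0).
    by rewrite properEneq mono // andbT; apply/negP => /eqP /injf.
  by move=> /proper_card; lia.
exact: mono.
Qed.

Lemma e_num_osum1l (d : Order.disp_t) (P : finPOrderType d) :
  0 < #|P| -> e_num P < e_num ('I_1 ⊕ P).
Proof.
move=> P0; have [freeP _] := e_numP P0.
have P10 : 0 < #|{: 'I_1 ⊕ P}| by apply/card_gt0P; exists (inl ord0).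
by have [_] := e_numP P10; apply; apply: levels_free_osum1l.
Qed.

Lemma e_num_osum1r (d : Order.disp_t) (P : finPOrderType d) :
  0 < #|P| -> e_num P < e_num (P ⊕ 'I_1).
Proof.
move=> P0; have [freeP _] := e_numP P0.
have P10 : 0 < #|{: P ⊕ 'I_1}| by apply/card_gt0P; exists (inr ord0).
by have [_] := e_numP P10; apply; apply: levels_free_osum1r.
Qed.

(** * Transpositions acting on sets and on full chains *)

(** Exchanging a point of [X :\: Y] with one of [Y :\: X] shrinks [X :\: Y], so finitely many
    transpositions carry [X] to [Y]. *)
Lemma tperm_invariant_card (T : finType) (f : {set T} -> nat) :
    (forall x y (Z : {set T}), f [set tperm x y z | z in Z] = f Z) ->
  forall X Y : {set T}, #|X| = #|Y| -> f X = f Y.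
Proof.
move=> finv X Y; have [m] := ubnP #|X :\: Y|.
elim: m X => // m IHm X ltXY eqXY.
have [/eqP|[x]] := set_0Vmem (X :\: Y).
  rewrite setD_eq0 => sXY; apply: congr1; apply/eqP.
  by rewrite eqEcard sXY eqXY leqnn.
have [/eqP|[y]] := set_0Vmem (Y :\: X).
  rewrite setD_eq0 => sYX _; apply: congr1; apply/eqP.
  by rewrite eq_sym eqEcard sYX eqXY leqnn.
rewrite !inE => /andP[yX yY] /andP[xY xX].
rewrite -(finv x y); apply: IHm; last by rewrite card_imset //; apply: perm_inj.
rewrite -ltnS; apply: leq_trans ltXY; rewrite ltnS; apply: proper_card.
apply/properP; split; last first.
  exists x; rewrite ?inE ?xY //=.
  apply/imsetP => -[z zX /esym]; rewrite -{2}(tpermR x y) => /perm_inj Ezy.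
  by rewrite -Ezy zX in yX.
apply/subsetP => w; rewrite !inE => /andP[wY /imsetP[z zX Ew]].
move: Ew; case: tpermP => [_ wy|zy|_ _ wz]; last by rewrite wY wz.
- by rewrite wy yY in wY.
- by rewrite zy (negbTE yX) in zX.
Qed.

Lemma tperm_imset_id (T : finType) (x y : T) (Z : {set T}) :
  (x \in Z) = (y \in Z) -> [set tperm x y z | z in Z] = Z.
Proof.
move=> Exy; apply/eqP; rewrite eqEcard card_imset ?leqnn ?andbT; last exact: perm_inj.
by apply/subsetP => _ /imsetP[z zZ ->]; case: tpermP => [E|E|] //; [rewrite -Exy -E | rewrite Exy -E].
Qed.

Section Swap.
Context (n : nat).
Implicit Types (A B X Y : {set 'I_n}) (C D F G : {set {set 'I_n}}).

Definition set_swap (x y : 'I_n) X := [set tperm x y z | z in X].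

Lemma set_swapK x y : involutive (set_swap x y).
Proof.
move=> X; rewrite /set_swap -imset_comp -[RHS]imset_id.
by apply: eq_imset => z /=; rewrite tpermK.
Qed.

Lemma set_swapS x y X Y :
  (set_swap x y X \subset set_swap x y Y) = (X \subset Y).
Proof.
have S (U V : {set 'I_n}) : U \subset V -> set_swap x y U \subset set_swap x y V by apply: imsetS.
by apply/idP/idP => [/S|/S //]; rewrite !set_swapK.
Qed.

Lemma family_swapK x y C : set_swap x y @: (set_swap x y @: C) = C.
Proof.
rewrite -imset_comp -[RHS]imset_id.
by apply: eq_imset => X /=; rewrite set_swapK.
Qed.

Lemma mem_family_swap x y C X :
  (X \in set_swap x y @: C) = (set_swap x y X \in C).
Proof.
by rewrite -{1}[X](set_swapK x y) mem_imset //; apply: inv_inj (set_swapK x y).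
Qed.

Lemma full_chain_comparable C A B : C \in full_chains n -> A \in C -> B \in C ->
  (A \subset B) || (B \subset A).
Proof.
rewrite inE => /maxsetp chC AC BC.
exact: (forall_inP (forall_inP chC A AC)).
Qed.

(** A swap preserves inclusion and is its own inverse, so a chain extending the image of [C] swaps
    back to a chain extending [C]. *)
Lemma full_chain_swap x y C :
  C \in full_chains n -> set_swap x y @: C \in full_chains n.
Proof.
pose ch D := [forall A in D, forall B in D, (A \subset B) || (B \subset A)].
have chS D : ch D -> ch (set_swap x y @: D).
  move=> chD; apply/forall_inP => A; rewrite mem_family_swap => AD.
  apply/forall_inP => B; rewrite mem_family_swap => BD.
  by have := forall_inP (forall_inP chD _ AD) _ BD; rewrite !set_swapS.
rewrite !inE => maxC; apply/maxsetP; split; first exact: chS (maxsetp maxC).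
move=> D chD sCD; rewrite -[D](family_swapK x y); congr imset.
rewrite -(maxsetsup maxC (chS D chD)) // -[C](family_swapK x y).
exact: imsetS.
Qed.

End Swap.

(** * Full chains grouped by their extreme members in [G] *)

Section MinMax.
Context (n : nat) (G : {set {set 'I_n}}).
Implicit Types (A B X Y : {set 'I_n}) (C D : {set {set 'I_n}}).

(* When the chain misses G these take the junk values [set: 'I_n] and set0. *)
Definition chain_min C := \bigcap_(X in G :&: C) X.
Definition chain_max C := \bigcup_(X in G :&: C) X.

Definition minmax_class A B :=
  [set C in full_chains n | (chain_min C == A) && (chain_max C == B)].

Lemma minmax_class_between A B C X :
  C \in minmax_class A B -> X \in G :&: C -> (A \subset X) && (X \subset B).
Proof.
rewrite inE => /and3P[_ /eqP<- /eqP<-] XGC.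
by rewrite bigcap_inf // (bigcup_sup X).
Qed.

(** Proper inclusion excludes chains that miss [G], for which [A] would be the full set. On the
    others, the intersection and the union are attained at the members of least and greatest
    size. *)
Lemma minmax_class_ends A B C : A \proper B -> C \in minmax_class A B ->
  (A \in G :&: C) && (B \in G :&: C).
Proof.
move=> pAB CAB; have := CAB; rewrite inE => /and3P[fC /eqP minC /eqP maxC].
have [GC0|[X0 X0GC]] := set_0Vmem (G :&: C).
  move: pAB; rewrite -minC /chain_min GC0 big_set0.
  by rewrite properE subTset => /andP[_ /negP[]]; rewrite subsetT.
case: (arg_minnP (fun X : {set 'I_n} => #|X|) X0GC) => L LGC minL.
case: (arg_maxnP (fun X : {set 'I_n} => #|X|) X0GC) => U UGC maxU.
have cmp X Y : X \in G :&: C -> Y \in G :&: C -> (X \subset Y) || (Y \subset X).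
  rewrite in_setI => /andP[_ XC]; rewrite in_setI => /andP[_ YC].
  exact: full_chain_comparable fC XC YC.
have -> : A = L.
  rewrite -minC; apply/eqP; rewrite eqEsubset bigcap_inf //=.
  apply/bigcapsP => X XGC; case/orP: (cmp _ _ LGC XGC) => // sXL.
  by suff /eqP-> : X == L by []; rewrite eqEcard sXL; apply: minL.
have -> : B = U.
  rewrite -maxC; apply/eqP; rewrite eqEsubset (bigcup_sup U) //= andbT.
  apply/bigcupsP => X XGC; case/orP: (cmp _ _ UGC XGC) => // sUX.
  by suff /eqP-> : U == X by []; rewrite eqEcard sUX; apply: maxU.
by apply/andP.
Qed.

(* Permuting B :\: A fixes every set below A or above B, hence moves no set of
   G on the chain outside the interval. *)
Lemma minmax_class_swap A B C (x y : 'I_n) : A \proper B ->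
    x \in B :\: A -> y \in B :\: A ->
  C \in minmax_class A B -> set_swap x y @: C \in minmax_class A B.
Proof.
rewrite !in_setD => pAB /andP[xA xB] /andP[yA yB] CAB.
have [/andP[]] := (minmax_class_ends pAB CAB, CAB).
rewrite !in_setI => /andP[AG AC] /andP[BG BC] _.
have fC : C \in full_chains n by move: CAB; rewrite inE => /andP[].
have fSC := full_chain_swap x y fC.
have fixlow X : X \subset A -> set_swap x y X = X.
  move=> /subsetP sXA; apply: tperm_imset_id.
  by rewrite (negbTE (contra (sXA x) xA)) (negbTE (contra (sXA y) yA)).
have fixhigh X : B \subset X -> set_swap x y X = X.
  by move=> /subsetP sBX; apply: tperm_imset_id; rewrite !sBX.
have ASC : A \in set_swap x y @: C by rewrite mem_family_swap fixlow.
have BSC : B \in set_swap x y @: C by rewrite mem_family_swap fixhigh.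
(* [X] is comparable with [A] and [B]. If it lies below [A] or above [B], the swap fixes it, so it
   was already on [C]. *)
have btw X : X \in G :&: set_swap x y @: C -> (A \subset X) && (X \subset B).
  rewrite in_setI => /andP[XG XSC].
  have step : set_swap x y X = X -> (A \subset X) && (X \subset B).
    move: XSC; rewrite mem_family_swap => + E; rewrite E => XC.
    by apply: (minmax_class_between CAB); rewrite in_setI XG.
  case/orP: (full_chain_comparable fSC ASC XSC) => [sAX|/fixlow/step //].
  case/orP: (full_chain_comparable fSC BSC XSC) => [/fixhigh/step //|sXB].
  by rewrite sAX.
rewrite inE fSC !eqEsubset; apply/and3P; split=> //; apply/andP; split.
- by rewrite bigcap_inf // in_setI AG.
- by apply/bigcapsP => X /btw/andP[].
- by apply/bigcupsP => X /btw/andP[].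
- by rewrite (bigcup_sup B) // in_setI BG.
Qed.

End MinMax.

(** * The interval from [A] to [B] as a power set *)

Section Interval.
Context (n : nat) (A B : {set 'I_n}).
Implicit Types (Y Z : {set 'I_#|B :\: A|}).

(** Identifies the subsets of an ordinal type with the sets between [A] and [B], so that a Lubell
    bound valid for every ground set size applies to the interval. *)
Definition interval_embed Y : {set 'I_n} := A :|: [set enum_val i | i in Y].

Lemma interval_embed_mem i Y : (enum_val i \in interval_embed Y) = (i \in Y).
Proof.
have := enum_valP i; rewrite !inE => /andP[/negbTE -> _] /=.
by rewrite mem_imset //; apply: enum_val_inj.
Qed.

Lemma interval_embedS Y Z :
  (interval_embed Y \subset interval_embed Z) = (Y \subset Z).
Proof.
apply/idP/idP => [/subsetP sYZ|sYZ]; last by rewrite setUS // imsetS.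
by apply/subsetP => i; rewrite -!interval_embed_mem; apply: sYZ.
Qed.

Lemma interval_embed_proper Y Z :
  (interval_embed Y \proper interval_embed Z) = (Y \proper Z).
Proof. by rewrite !properE !interval_embedS. Qed.

Lemma interval_embed_inj : injective interval_embed.
Proof.
move=> Y Z E; apply/setP => i.
by rewrite -!interval_embed_mem E.
Qed.

Lemma card_interval_embed Y : #|interval_embed Y| = #|A| + #|Y|.
Proof.
rewrite cardsU disjoint_setI0 ?cards0 ?subn0.
  by rewrite card_imset //; apply: enum_val_inj.
rewrite disjoint_sym disjoint_subset; apply/subsetP => _ /imsetP[i _ ->].
by have := enum_valP i; rewrite !inE => /andP[].
Qed.

(** Transfers swaps of the small ground set to swaps of points of [B :\: A], which preserve the
    class of [A] and [B]. *)
Lemma interval_embed_swap i j Y :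
  interval_embed [set tperm i j z | z in Y] =
  set_swap (enum_val i) (enum_val j) (interval_embed Y).
Proof.
rewrite /interval_embed {1}/set_swap imsetU -/(set_swap _ _ _) tperm_imset_id; last first.
  have := enum_valP i; have := enum_valP j.
  by rewrite !inE => /andP[/negbTE-> _] /andP[/negbTE-> _].
congr (_ :|: _); rewrite -!imset_comp; apply: eq_imset => z /=.
exact/inj_tperm/enum_val_inj.
Qed.

Hypothesis sAB : A \subset B.

Lemma interval_embed0 : interval_embed set0 = A.
Proof. by rewrite /interval_embed imset0 setU0. Qed.

Lemma interval_embedP (X : {set 'I_n}) :
  reflect (exists Y, X = interval_embed Y) ((A \subset X) && (X \subset B)).
Proof.
apply: (iffP andP) => [[sAX sXB]|[Y ->]].
  exists [set i | enum_val i \in X]; apply/setP => x; rewrite !inE.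
  have [xA|xA] /= := boolP (x \in A); first exact: (subsetP sAX).
  apply/idP/imsetP => [xX|[i]]; last by rewrite inE => iX ->.
  have xBA : x \in B :\: A by rewrite inE xA (subsetP sXB).
  by exists (enum_rank_in xBA x); rewrite ?inE enum_rankK_in.
rewrite subsetUl; split=> //; rewrite subUset sAB; apply/subsetP => _ /imsetP[i _ ->].
by have := enum_valP i; rewrite !inE => /andP[].
Qed.

Lemma interval_embedT : interval_embed setT = B.
Proof.
have /interval_embedP[Y EY] : (A \subset B) && (B \subset B) by rewrite sAB subxx.
apply/eqP; rewrite eqEsubset; apply/andP; split.
  by have /andP[] : (A \subset interval_embed setT) && (interval_embed setT \subset B)
    by apply/interval_embedP; exists setT.
suff : interval_embed Y \subset interval_embed setT by rewrite -EY.
by rewrite interval_embedS subsetT.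
Qed.

End Interval.

(** * Averages over one class of chains *)

Section IntervalAverage.
Context (n : nat) (G : {set {set 'I_n}}) (A B : {set 'I_n}).
Hypothesis pAB : A \proper B.

Local Notation m := #|B :\: A|.
Local Notation emb := (@interval_embed n A B).
Local Notation K := (minmax_class G A B).

(** The empty and full sets, which correspond to [A] and [B], are left out because central
    L-boundedness concerns families without them. *)
Definition interval_trace : {set {set 'I_m}} :=
  [set Y | [&& emb Y \in G, Y != set0 & Y != setT]].

Let sAB : A \subset B := proper_sub pAB.

(** This is the uniformity of the chain inside the interval: swaps show that the count depends only
    on [#|Y|], and each chain of the class passes through exactly one embedded set of that size. The
    product form also covers an empty class. *)
Lemma card_minmax_class_through (Y : {set 'I_m}) :
  #|[set C in K | emb Y \in C]| * 'C(m, #|Y|) = #|K|.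
Proof.
pose N (Z : {set 'I_m}) := #|[set C in K | emb Z \in C]|.
have leN i j (Z : {set _}) : N Z <= N [set tperm i j z | z in Z].
  have injs := imset_inj (inv_inj (@set_swapK n (enum_val i) (enum_val j))).
  rewrite /N -(card_imset _ injs); apply/subset_leq_card/subsetP.
  move=> _ /imsetP[C + ->]; rewrite in_set => /andP[CK ZC]; rewrite in_set.
  apply/andP; split; last by rewrite interval_embed_swap imset_f.
  exact: minmax_class_swap pAB (enum_valP i) (enum_valP j) CK.
have eqN i j (Z : {set _}) : N [set tperm i j z | z in Z] = N Z.
  apply/eqP; rewrite eqn_leq leN andbT.
  have {2}<- : set_swap i j (set_swap i j Z) = Z by apply: set_swapK.
  exact: leN.
rewrite -/(N Y).
(* Double count the pairs of a chain in the class and a set of size [#|Y|] embedded on it. *)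
transitivity (\sum_(Z : {set 'I_m} | #|Z| == #|Y|) N Z).
  rewrite (eq_bigr (fun=> N Y)) => [|Z /eqP/(tperm_invariant_card eqN) //].
  by rewrite sum_nat_cond_const mulnC -{1}[m]card_ord -card_draws cardsE.
under eq_bigr do rewrite /N -sum1_card.
rewrite (exchange_big_dep (mem K)) /=; last by move=> Z C _; rewrite inE => /andP[].
rewrite -[RHS]sum1_card; apply: eq_bigr => C CK.
have fC : C \in full_chains n by move: CK; rewrite inE => /andP[].
have /andP[] := minmax_class_ends pAB CK.
rewrite !in_setI => /andP[_ AC] /andP[_ BC].
have leY : #|Y| <= #|B| - #|A|.
  by rewrite -(cardsDS sAB) -[X in _ <= X]card_ord max_card.
have leAB := subset_leq_card sAB.
have leB : #|B| <= n by rewrite -[X in _ <= X]card_ord max_card.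
have lek : #|A| + #|Y| <= n by lia.
transitivity #|emb @: [set Z : {set 'I_m} | #|Z| == #|Y| & emb Z \in C]|.
  rewrite card_imset; last exact: interval_embed_inj.
  by rewrite -sum1_card; apply: eq_bigl => Z; rewrite [RHS]in_set [in LHS]in_set CK.
rewrite -(full_chain_level fC lek); congr #|pred_of_set _|; apply/setP => X.
apply/imsetP/idP => [[Z]|].
  rewrite inE => /andP[/eqP cZ ZC] ->.
  by rewrite inE ZC card_interval_embed cZ eqxx.
(* The member of [C] of size [#|A| + #|Y|] is comparable with [A] and [B], and its size forces it
   between them. *)
rewrite inE => /andP[XC /eqP cX].
have /interval_embedP[] : (A \subset X) && (X \subset B).
- apply/andP; split.
    case/orP: (full_chain_comparable fC AC XC) => // sXA.
    by suff /eqP-> : X == A by []; rewrite eqEcard sXA cX leq_addr.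
  case/orP: (full_chain_comparable fC BC XC) => // sBX.
  by suff /eqP-> : B == X by []; rewrite eqEcard sBX cX; lia.
- exact: sAB.
move=> Z EX; exists Z => //; rewrite inE -EX XC andbT.
by move: cX; rewrite EX card_interval_embed => /addnI ->.
Qed.

(** The summand 2 counts the distinct ends [A] and [B]; all other members of [G] on the chain are
    embedded sets of the trace. *)
Lemma card_minmax_chain C : C \in K ->
  #|G :&: C| = 2 + #|[set Y in interval_trace | emb Y \in C]|.
Proof.
move=> CK; have /andP[AGC BGC] := minmax_class_ends pAB CK.
have -> : G :&: C = A |: (B |: emb @: [set Y in interval_trace | emb Y \in C]).
  apply/setP => X; rewrite !in_setU1.
  apply/idP/or3P => [XGC|[/eqP->|/eqP->|/imsetP[Y + ->]] //]; last first.
    by rewrite inE [Y \in _]inE in_setI => /andP[/and3P[-> _ _] ->].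
  have /(interval_embedP sAB)[Y EX] := minmax_class_between CK XGC.
  have [Y0|nY0] := eqVneq Y set0.
    by constructor 1; rewrite EX Y0 interval_embed0.
  have [YT|nYT] := eqVneq Y setT.
    by constructor 2; rewrite EX YT interval_embedT.
  constructor 3; rewrite EX imset_f // inE [Y \in _]inE nY0 nYT !andbT.
  by move: XGC; rewrite EX in_setI.
rewrite !cardsU1 card_imset; last exact: interval_embed_inj.
have nB : B \notin emb @: [set Y in interval_trace | emb Y \in C].
  apply/imsetP => -[Y]; rewrite inE [Y \in _]inE => /andP[/and3P[_ _ YT] _].
  by rewrite -[LHS](interval_embedT sAB) => /interval_embed_inj /esym /eqP; rewrite (negbTE YT).
have nA : A \notin emb @: [set Y in interval_trace | emb Y \in C].
  apply/imsetP => -[Y]; rewrite inE [Y \in _]inE => /andP[/and3P[_ Y0 _] _].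
  by rewrite -[LHS](interval_embed0 A B) => /interval_embed_inj /esym /eqP; rewrite (negbTE Y0).
have nAB : A != B by move: pAB; rewrite properEneq => /andP[].
by rewrite in_setU1 (negbTE nAB) nA nB.
Qed.

(** Exchanging the sums, each [Y] of the trace contributes [#|K|] divided by ['C(m, #|Y|)], its term
    in the Lubell function. *)
Lemma sum_minmax_class :
  ((\sum_(C in K) #|G :&: C|)%:R
    = #|K|%:R * (2%:R + lubell interval_trace) :> rat)%R.
Proof.
rewrite (eq_bigr _ card_minmax_chain) big_split /= sum_nat_const.
rewrite natrD natrM [RHS]mulrDr; congr (_ + _)%R.
transitivity ((\sum_(Y in interval_trace) #|[set C in K | emb Y \in C]|)%:R : rat)%R.
  congr (_%:R)%R.
  under eq_bigr do rewrite -sum1_card.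
  rewrite (exchange_big_dep (mem interval_trace)) /=; last first.
    by move=> C Y _; rewrite inE => /andP[].
  apply: eq_bigr => Y YT; rewrite -[RHS]sum1_card; apply: eq_bigl => C.
  by rewrite [RHS]in_set; congr (_ && _); rewrite in_set YT.
rewrite natr_sum lubellE mulr_sumr; apply: eq_bigr => Y _.
rewrite -(card_minmax_class_through Y) natrM mulfK // pnatr_eq0 -lt0n bin_gt0.
by rewrite -[X in _ <= X]card_ord max_card.
Qed.

End IntervalAverage.

(** * The Lubell bound for families with [P]-free open intervals *)

Definition strictly_between (n : nat) (A B : {set 'I_n}) (G : {set {set 'I_n}}) :=
  [set X in G | (A \proper X) && (X \proper B)].

(* Chains are grouped by their least and greatest elements in G; within a group
   the part strictly between these ends is uniformly distributed. *)
Lemma lubell_le_interval_free (d : Order.disp_t) (P : finPOrderType d)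
    (n : nat) (G : {set {set 'I_n}}) :
    centrally_L_bounded P ->
    (forall A B, A \in G -> B \in G -> A \proper B ->
      poset_free P (strictly_between A B G)) ->
  (lubell G <= (e_num P).+2%:R)%R.
Proof.
move=> centralP freeG.
have F0 : (0 < #|full_chains n|%:R :> rat)%R by rewrite ltr0n full_chains_gt0.
rewrite /lubell ler_pdivrMr //.
pose mm (C : {set {set 'I_n}}) := (chain_min G C, chain_max G C).
(* Splitting both the incidences and the number of chains by class reduces the bound to one
   class. *)
rewrite (partition_big mm xpredT) //= -[in leRHS]sum1_card.
rewrite (partition_big mm xpredT) //= !natr_sum mulr_sumr.
apply: ler_sum => -[A B] _.
have EK C : (C \in full_chains n) && (mm C == (A, B)) = (C \in minmax_class G A B).
  by rewrite [RHS]in_set xpair_eqE.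
rewrite !(eq_bigl _ _ EK) sum1_card.
(* Without proper inclusion, any member of [G] on the chain is squeezed between [A] and [B] and
   equals both, so there is at most one. *)
have [pAB|npAB] := boolP (A \proper B); last first.
  rewrite -natrM ler_nat mulnC -sum_nat_const; apply: leq_sum => C CK.
  suff : #|G :&: C| <= 1 by move/leq_trans; apply.
  apply/card_le1_eqP => X Y /(minmax_class_between CK) /andP[sAX sXB] YGC.
  have /andP[sAY sYB] := minmax_class_between CK YGC.
  have /eqP EAB : A == B by rewrite eqEproper npAB (subset_trans sAX).
  have E (Z : {set 'I_n}) : A \subset Z -> Z \subset B -> Z = A.
    by move=> sAZ sZB; apply/eqP; rewrite eqEsubset sAZ {1}EAB sZB.
  by rewrite (E X) // (E Y).
rewrite sum_minmax_class // mulrC.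
have [->|[C CK]] := set_0Vmem (minmax_class G A B).
  by rewrite cards0 !mulr0.
apply: ler_wpM2r; first exact: ler0n.
have /andP[] := minmax_class_ends pAB CK.
rewrite !in_setI => /andP[AG _] /andP[BG _].
(* The ends account for 2; the hypothesis on [P] bounds the trace, where a copy of [P] would embed
   strictly between [A] and [B]. *)
rewrite -[(e_num P).+2]add2n [leRHS]natrD lerD2l; apply: centralP; last 2 first.
- by rewrite inE eqxx andbF.
- by rewrite inE eqxx !andbF.
move=> [f [injf fG mono]]; apply: (freeG A B AG BG pAB).
have sAB := proper_sub pAB.
exists (fun u => interval_embed (f u)); split=> [u v|u|u v /mono].
- by move=> /interval_embed_inj /injf.
- have := fG u; rewrite !inE => /and3P[-> Y0 YT] /=.
  have := interval_embed_proper set0 (f u); rewrite interval_embed0 => ->.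
  have := interval_embed_proper (f u) setT; rewrite interval_embedT // => ->.
  by rewrite !properEneq eq_sym Y0 YT sub0set subsetT.
- by rewrite interval_embedS.
Qed.

(** * Adjoining a set to a family or a point to a copy of [P] *)

Lemma lubellU1 (n : nat) (A : {set 'I_n}) (F : {set {set 'I_n}}) :
  A \notin F -> lubell (A |: F) = (('C(n, #|A|)%:R)^-1 + lubell F)%R.
Proof. by move=> AF; rewrite !lubellE big_setU1. Qed.

Lemma contains_poset_osum1l (d : Order.disp_t) (P : finPOrderType d) (n : nat)
    (F : {set {set 'I_n}}) (A : {set 'I_n}) :
  A \in F -> contains_poset P [set X in F | A \proper X] ->
  contains_poset ('I_1 ⊕ P) F.
Proof.
move=> AF [f [injf fF mono]].
have fFE u : f u \in F /\ A \proper f u by have := fF u; rewrite inE => /andP[].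
have fA u : f u <> A by move=> fuA; have [_] := fFE u; rewrite fuA properxx.
exists (fun x => if x is inr u then f u else A); split.
- move=> [i|u] [j|v]; first by rewrite !ord1.
  + by move=> /esym/fA.
  + by move=> /fA.
  + by move=> /injf ->.
- by case=> // u; have [] := fFE u.
- move=> [i|u] [j|v] //.
  + by have [_ /proper_sub] := fFE v.
  + exact: mono.
Qed.

Lemma contains_poset_osum1r (d : Order.disp_t) (P : finPOrderType d) (n : nat)
    (F : {set {set 'I_n}}) (B : {set 'I_n}) :
  B \in F -> contains_poset P [set X in F | X \proper B] ->
  contains_poset (P ⊕ 'I_1) F.
Proof.
move=> BF [f [injf fF mono]].
have fFE u : f u \in F /\ f u \proper B by have := fF u; rewrite inE => /andP[].
have fB u : f u <> B by move=> fuB; have [_] := fFE u; rewrite fuB properxx.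
exists (fun x => if x is inl u then f u else B); split.
- move=> [u|i] [v|j]; last by rewrite !ord1.
  + by move=> /injf ->.
  + by move=> /fB.
  + by move=> /esym/fB.
- by case=> // u; have [] := fFE u.
- move=> [u|i] [v|j] //.
  + exact: mono.
  + by have [_ /proper_sub] := fFE u.
Qed.

Lemma contains_posetS (d : Order.disp_t) (P : finPOrderType d) (n : nat)
    (F G : {set {set 'I_n}}) :
  F \subset G -> contains_poset P F -> contains_poset P G.
Proof.
move=> /subsetP sFG [f [injf fF mono]].
by exists f; split=> // u; apply: sFG.
Qed.

(** * The three bounds for ordinal sums *)

Lemma centrally_L_bounded_osum1l (d : Order.disp_t) (P : finPOrderType d) :
  0 < #|P| -> centrally_L_bounded P -> centrally_L_bounded ('I_1 ⊕ P).
Proof.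
move=> P0 centralP n F freeF F0 FT.
apply: (@le_trans _ _ (e_num P).+1%:R%R); last by rewrite ler_nat e_num_osum1l.
(* Adding 1 to both sides turns the left into the Lubell value of [setT |: F] and the right into
   [e_num P] plus 2. *)
rewrite -(lerD2l 1%R).
have <- : (lubell (setT |: F) = 1 + lubell F)%R.
  by rewrite lubellU1 // cardsT card_ord binn invr1.
rewrite nat1r.
apply: lubell_le_interval_free => // A B AG BG pAB.
(* The added full set can serve only as the upper end, so [A] and all sets strictly between lie in
   [F]. *)
have AF : A \in F.
  move: AG; rewrite in_setU1 => /orP[/eqP AT|//].
  by move: pAB; rewrite AT properE subsetT andbF.
apply: contra_not freeF => cP; apply: (contains_poset_osum1l AF).
apply: contains_posetS cP; apply/subsetP => X; rewrite !inE => /and3P[XG -> pXB].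
rewrite andbT; case/orP: XG => // /eqP XT.
by move: pXB; rewrite XT properE subsetT andbF.
Qed.

Lemma centrally_L_bounded_osum1r (d : Order.disp_t) (P : finPOrderType d) :
  0 < #|P| -> centrally_L_bounded P -> centrally_L_bounded (P ⊕ 'I_1).
Proof.
move=> P0 centralP n F freeF F0 FT.
apply: (@le_trans _ _ (e_num P).+1%:R%R); last by rewrite ler_nat e_num_osum1r.
rewrite -(lerD2l 1%R).
have <- : (lubell (set0 |: F) = 1 + lubell F)%R.
  by rewrite lubellU1 // cards0 bin0 invr1.
rewrite nat1r.
apply: lubell_le_interval_free => // A B AG BG pAB.
(* Dually, the added empty set can serve only as the lower end. *)
have BF : B \in F.
  move: BG; rewrite in_setU1 => /orP[/eqP B0|//].
  by move: pAB; rewrite B0 properE sub0set andbF.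
apply: contra_not freeF => cP; apply: (contains_poset_osum1r BF).
apply: contains_posetS cP; apply/subsetP => X; rewrite !inE => /and3P[XG pAX ->].
rewrite andbT; case/orP: XG => // /eqP X0.
by move: pAX; rewrite X0 properE sub0set andbF.
Qed.

Lemma uniformly_L_bounded_osum11 (d : Order.disp_t) (P : finPOrderType d) :
  0 < #|P| -> centrally_L_bounded P -> uniformly_L_bounded ('I_1 ⊕ P ⊕ 'I_1).
Proof.
move=> P0 centralP n F freeF.
have P10 : 0 < #|{: 'I_1 ⊕ P}| by apply/card_gt0P; exists (inl ord0).
apply: (@le_trans _ _ (e_num P).+2%:R%R); last first.
  (* The bottom and the top each raise [e_num] by at least 1. *)
  by rewrite ler_nat; apply: leq_trans (e_num_osum1r P10); rewrite ltnS e_num_osum1l.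
apply: lubell_le_interval_free => // A B AF BF pAB.
(* The sum associates to the left, so the top [B] is split off before the bottom [A]. *)
apply: contra_not freeF => cP; apply: (contains_poset_osum1r BF).
apply: (@contains_poset_osum1l _ _ _ _ A); first by rewrite inE AF.
apply: contains_posetS cP; apply/subsetP => X.
by rewrite !inE => /and3P[-> -> ->].
Qed.

Theorem theorem6p1 (d : Order.disp_t) (P : finPOrderType d)
    (P_nonempty : 0 < #|P|) (P_central : centrally_L_bounded P) :
  [/\ centrally_L_bounded ('I_1 ⊕ P),
      centrally_L_bounded (P ⊕ 'I_1) &
      uniformly_L_bounded ('I_1 ⊕ P ⊕ 'I_1)].
Proof.
split; [exact: centrally_L_bounded_osum1l | exact: centrally_L_bounded_osum1r |].
exact: uniformly_L_bounded_osum11.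
Qed.
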